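(* For any $\epsilon\in(0,1)$, with probability at least $1-\delta$ over the i.i.d. sample $x_1,x_2,\dots\sim D_X$, \[V_{P,\pi,t}\le(1+\epsilon)\,\widehat V_{P,\pi,t}+\frac{7500}{\epsilon^3}K\] for all distributions $P$ over $\Pi$, all $\pi\in\Pi$, and all $t\ge 16K\log(8KN/\delta)$.
   Context: $A$ is a set of $K$ actions, $X$ a set of contexts, $\Pi$ a finite set of $N$ policies $\pi:X\to A$, $D_X$ a distribution on $X$, and $\delta\in(0,1)$. For a distribution $P$ over $\Pi$, $W_P(x,a)=\sum_{\pi:\pi(x)=a}P(\pi)$. Let $C_t=2\log(Nt/\delta)$ and $\mu_t=\min\{\frac1{2K},\sqrt{C_t/(2Kt)}\}$. For a distribution $P$ over $\Pi$, $\pi\in\Pi$ and $t\ge 2$, define $V_{P,\pi,t}=\mathbb{E}_{x\sim D_X}\bigl[1/((1-K\mu_t)W_P(x,\pi(x))+\mu_t)\bigr]$ and $\widehat V_{P,\pi,t}=\frac1{t-1}\sum_{i=1}^{t-1}1/((1-K\mu_t)W_P(x_i,\pi(x_i))+\mu_t)$. *)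

(* Defs.v *)
From HB Require Import structures.
From mathcomp Require Import all_boot all_order all_algebra.
From mathcomp Require Import all_classical all_reals all_analysis.
Set Implicit Arguments. Unset Strict Implicit. Unset Printing Implicit Defensive.
Import Order.TTheory GRing.Theory Num.Theory.
Local Open Scope classical_set_scope.
Local Open Scope ring_scope.

(* Policies are indexed by 'I_N, actions are 'I_K, contexts live in a
   measurable type X.  A distribution over Pi is a probability vector. *)
Definition is_dist (R : realType) (N : nat) (P : 'I_N -> R) : Prop :=
  (forall i, 0 <= P i) /\ \sum_(i < N) P i = 1.

Definition W (R : realType) (X : Type) (K N : nat) (pol : 'I_N -> X -> 'I_K)
  (P : 'I_N -> R) (x : X) (a : 'I_K) : R :=
  \sum_(i < N | pol i x == a) P i.

Definition C_t (R : realType) (N : nat) (delta : R) (t : nat) : R :=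
  2 * ln (N%:R * t%:R / delta).

Definition mu_t (R : realType) (K N : nat) (delta : R) (t : nat) : R :=
  Num.min (2 * K%:R)^-1 (Num.sqrt (C_t N delta t / (2 * K%:R * t%:R))).

Definition Vterm (R : realType) (X : Type) (K N : nat) (pol : 'I_N -> X -> 'I_K)
  (delta : R) (P : 'I_N -> R) (j : 'I_N) (t : nat) (x : X) : R :=
  ((1 - K%:R * mu_t K N delta t) * W pol P x (pol j x) + mu_t K N delta t)^-1.

Definition V (R : realType) d (X : measurableType d) (K N : nat)
  (pol : 'I_N -> X -> 'I_K) (DX : probability X R) (delta : R)
  (P : 'I_N -> R) (j : 'I_N) (t : nat) : \bar R :=
  (\int[DX]_x (Vterm pol delta P j t x)%:E)%E.

Definition Vhat (R : realType) (X : Type) (K N : nat) (pol : 'I_N -> X -> 'I_K)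
  (delta : R) (P : 'I_N -> R) (j : 'I_N) (t : nat) (xs : nat -> X) : R :=
  (t.-1%:R)^-1 * \sum_(1 <= i < t) Vterm pol delta P j t (xs i).

Definition iid_seq (R : realType) d d' (Omega : measurableType d)
  (X : measurableType d') (Pr : probability Omega R) (D : probability X R)
  (x : nat -> Omega -> X) : Prop :=
  (forall n, measurable_fun setT (x n)) /\
  forall (s : seq nat) (B : nat -> set X), uniq s ->
    (forall i, i \in s -> measurable (B i)) ->
    Pr (\bigcap_(i in [set i | i \in s]) (x i @^-1` B i)) =
      (\prod_(i <- s) D (B i))%E.

(* Main.v *)
(** Given P, draw m policies independently from P.  If Y is the denominator
    (1 - K mu) W + mu with W replaced by its empirical version, then
    E[1/Y] lies between 1/E[Y] and (1 + 1/(m mu))/E[Y], so with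
    m about 4/(mu eps) the inequality for P follows by averaging the inequality
    for the at most N^m empirical distributions.  For these, 1/Y takes values in
    [0, 1/mu], and a multiplicative Chernoff bound with a union bound suffices;
    the resulting error is of order C_t / (t mu^2 eps^2), and the lower bound on
    t forces mu^2 = C_t / (2Kt).  Since everything depends on a context only
    through the finite vector of actions chosen by all the policies, all the
    probabilities are finite sums. *)

Require Import Defs.
From HB Require Import structures.
From mathcomp Require Import all_boot all_order all_algebra.
From mathcomp Require Import all_classical all_reals all_analysis.
From mathcomp Require Import measurable_realfun ring lra.
Import Order.TTheory GRing.Theory Num.Theory.
Local Open Scope classical_set_scope.
Local Open Scope ring_scope.

(** * Expectation over independent draws from a finite distribution *)

Definition iidE {R : realType} {J : finType} (P : J -> R) {m : nat}
  (g : {ffun 'I_m -> J} -> R) : R :=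
  \sum_(f : {ffun 'I_m -> J}) (\prod_(i < m) P (f i)) * g f.

(** With [q = 1 - K mu] and [S] the policies agreeing with the given one at a context, this is
    [Vterm]. In [inv_count], [P] is replaced by the empirical distribution of the tuple [f]. *)
Definition inv_weight {R : realType} {J : finType} (q mu : R) (S : pred J)
  (P : J -> R) : R := (q * \sum_(j | S j) P j + mu)^-1.

Definition inv_count {R : realType} {J : finType} (q mu : R) (S : pred J)
  {m : nat} (f : {ffun 'I_m -> J}) : R :=
  (q * (m%:R^-1 * \sum_(i < m) (S (f i))%:R) + mu)^-1.

Section IidExpectation.
Context {R : realType} {J : finType} {P : J -> R} {m : nat}.
Hypotheses (P0 : forall j, 0 <= P j) (P1 : \sum_j P j = 1).
Implicit Types (g : {ffun 'I_m -> J} -> R) (h : J -> R).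

Lemma iidE_prod (G : 'I_m -> J -> R) :
  iidE P (fun f => \prod_i G i (f i)) = \prod_i \sum_j P j * G i j.
Proof.
rewrite bigA_distr_bigA /iidE; apply: eq_bigr => f _.
by rewrite -big_split.
Qed.

Lemma iidE_cst (c : R) : iidE P (fun _ : {ffun 'I_m -> J} => c) = c.
Proof.
rewrite /iidE -mulr_suml -(bigA_distr_bigA (fun=> P)).
by rewrite big1 ?mul1r.
Qed.

Lemma iidED g1 g2 : iidE P (fun f => g1 f + g2 f) = iidE P g1 + iidE P g2.
Proof. by rewrite /iidE -big_split; apply: eq_bigr => f _; rewrite mulrDr. Qed.

Lemma iidEZ (c : R) g : iidE P (fun f => c * g f) = c * iidE P g.
Proof. by rewrite /iidE mulr_sumr; apply: eq_bigr => f _; rewrite mulrCA. Qed.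

Lemma iidE_sum (I : Type) (r : seq I) (F : I -> {ffun 'I_m -> J} -> R) :
  iidE P (fun f => \sum_(i <- r) F i f) = \sum_(i <- r) iidE P (F i).
Proof.
by rewrite /iidE exchange_big; apply: eq_bigr => f _; rewrite mulr_sumr.
Qed.

Lemma le_iidE g1 g2 : (forall f, g1 f <= g2 f) -> iidE P g1 <= iidE P g2.
Proof.
by move=> g12; apply: ler_sum => f _; rewrite ler_wpM2l// prodr_ge0.
Qed.

Lemma eq_iidE g1 g2 : g1 =1 g2 -> iidE P g1 = iidE P g2.
Proof. by move=> g12; apply: eq_bigr => f _; rewrite g12. Qed.

Lemma iidE_coord h (i : 'I_m) : iidE P (fun f => h (f i)) = \sum_j P j * h j.
Proof.
transitivity (iidE P (fun f => \prod_k (if k == i then h (f k) else 1))).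
  by apply: eq_iidE => f; rewrite -big_mkcond big_pred1_eq.
rewrite (iidE_prod (fun k j => if k == i then h j else 1)) (bigD1 i)//= eqxx.
rewrite [X in _ * X]big1 ?mulr1// => k /negPf ->.
by under eq_bigr do rewrite mulr1.
Qed.

(** Distinct coordinates are independent, so the mean factorises into vanishing means; only the
    diagonal then survives in the second moment of the sum. *)
Lemma iidE_coord2 h (i k : 'I_m) : \sum_j P j * h j = 0 -> i != k ->
  iidE P (fun f => h (f i) * h (f k)) = 0.
Proof.
move=> h0 ik.
transitivity (iidE P (fun f => \prod_l
    ((if l == i then h (f l) else 1) * (if l == k then h (f l) else 1)))).
  by apply: eq_iidE => f; rewrite big_split -!big_mkcond !big_pred1_eq.
rewrite (iidE_prod (fun l j =>
  (if l == i then h j else 1) * (if l == k then h j else 1))) (bigD1 i)//=.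
rewrite eqxx (negPf ik); under eq_bigr do rewrite mulr1.
by rewrite h0 mul0r.
Qed.

Lemma iidE_sum_sqr h : \sum_j P j * h j = 0 ->
  iidE P (fun f => (\sum_(i < m) h (f i)) ^+ 2) =
  m%:R * \sum_j P j * h j ^+ 2.
Proof.
move=> h0.
transitivity (\sum_(i < m) \sum_(k < m) iidE P (fun f => h (f i) * h (f k))).
  transitivity (iidE P (fun f => \sum_(i < m) \sum_(k < m) h (f i) * h (f k))).
    apply: eq_iidE => f; rewrite expr2 mulr_suml; apply: eq_bigr => i _.
    by rewrite mulr_sumr.
  by rewrite iidE_sum; apply: eq_bigr => i _; rewrite iidE_sum.
transitivity (\sum_(i < m) \sum_j P j * h j ^+ 2).
  apply: eq_bigr => i _; rewrite (bigD1 i)//= big1 ?addr0 => [|k ki].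
    exact: (iidE_coord (fun j => h j * h j)).
  by rewrite iidE_coord2// eq_sym.
by rewrite sumr_const card_ord mulr_natl.
Qed.

(* With Y the sampled denominator and a its mean,
   1/Y = 1/a - (Y-a)/a^2 + (Y-a)^2/(a^2 Y); the linear term averages to zero
   and the variance of Y is at most a/m. *)
Lemma sample_inv (S : pred J) (q mu : R) :
    (0 < m)%N -> 0 <= q <= 1 -> 0 < mu ->
  inv_weight q mu S P <= iidE P (fun f : {ffun 'I_m -> J} => inv_count q mu S f)
  <= (1 + (m%:R * mu)^-1) * inv_weight q mu S P.
Proof.
rewrite /inv_weight /inv_count => m0 /andP[q0 q1] mu0.
set p := \sum_(j | _) _; set a := q * p + mu.
have p0 : 0 <= p by apply: sumr_ge0.
have a0 : 0 < a by rewrite ltr_wpDl// mulr_ge0.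
have m0' : 0 < m%:R :> R by rewrite ltr0n.
pose h j := (S j)%:R - p.
have hp : \sum_j P j * (S j)%:R = p.
  rewrite /p [RHS]big_mkcond; apply: eq_bigr => j _.
  by case: (S j); rewrite ?mulr1 ?mulr0.
have h0 : \sum_j P j * h j = 0.
  under eq_bigr do rewrite mulrBr.
  by rewrite sumrB hp -mulr_suml P1 mul1r subrr.
(* [S j] takes the values 0 and 1 with mean [p], so its variance is [p - p ^+ 2]. *)
have h2 : \sum_j P j * h j ^+ 2 <= p.
  have -> : \sum_j P j * h j ^+ 2 =
      \sum_j (P j * (S j)%:R * (1 - 2 * p) + P j * p ^+ 2).
    by apply: eq_bigr => j _; rewrite /h; case: (S j) => /=; ring.
  by rewrite big_split /= -!mulr_suml hp P1; nra.
pose Y (f : {ffun 'I_m -> J}) := q * (m%:R^-1 * \sum_(i < m) (S (f i))%:R) + mu.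
have Ymu f : mu <= Y f.
  by rewrite lerDr mulr_ge0// mulr_ge0//; apply: sumr_ge0.
have Y0 f : 0 < Y f by exact: lt_le_trans (Ymu f).
have Ya f : Y f - a = q / m%:R * \sum_(i < m) h (f i).
  rewrite /Y /a sumrB sumr_const card_ord -mulr_natl.
  by field; rewrite gt_eqF.
have EY : iidE P (fun f => Y f - a) = 0.
  rewrite (eq_iidE _ _ Ya) iidEZ iidE_sum big1 ?mulr0// => i _.
  by rewrite iidE_coord.
have EY2 : iidE P (fun f => (Y f - a) ^+ 2) <= a / m%:R.
  have -> : iidE P (fun f => (Y f - a) ^+ 2) =
      q ^+ 2 / m%:R * \sum_j P j * h j ^+ 2.
    rewrite (eq_iidE _ (fun f => (q / m%:R) ^+ 2 *
      (\sum_(i < m) h (f i)) ^+ 2)) => [|f]; last by rewrite Ya exprMn.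
    by rewrite iidEZ iidE_sum_sqr//; field; rewrite gt_eqF.
  rewrite mulrAC ler_pM2r ?invr_gt0//.
  apply: (@le_trans _ _ (q ^+ 2 * p)); first by rewrite ler_wpM2l ?exprn_ge0.
  have : q * p * q <= q * p by rewrite ler_piMr// mulr_ge0.
  by rewrite /a; lra.
have expand f : (Y f)^-1 =
    a^-1 + (- a ^- 2 * (Y f - a) + a ^- 2 * ((Y f)^-1 * (Y f - a) ^+ 2)).
  by field; rewrite !gt_eqF.
apply/andP; split.
  have -> : a^-1 = iidE P (fun f => a^-1 + - a ^- 2 * (Y f - a)).
    by rewrite iidED iidE_cst iidEZ EY mulr0 addr0.
  apply: le_iidE => f; rewrite -/(Y f) [leRHS]expand lerD2l lerDl.
  rewrite mulr_ge0 ?invr_ge0 ?exprn_ge0 ?(ltW a0)// mulr_ge0 ?sqr_ge0//.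
  by rewrite invr_ge0 ltW.
(* Bounding [1/Y] by [1/mu] in the remainder leaves a quadratic in [Y], whose mean the variance
   controls. *)
apply: (@le_trans _ _ (iidE P (fun f => a^-1 +
    (- a ^- 2 * (Y f - a) + a ^- 2 / mu * (Y f - a) ^+ 2)))).
  apply: le_iidE => f; rewrite -/(Y f) [leLHS]expand !lerD2l -[leRHS]mulrA.
  rewrite ler_wpM2l ?invr_ge0 ?exprn_ge0 ?(ltW a0)//.
  by rewrite ler_wpM2r ?sqr_ge0// lef_pV2// posrE.
rewrite 2!iidED 2!iidEZ iidE_cst EY mulr0 add0r mulrDl mul1r lerD2l.
have -> : (m%:R * mu)^-1 * a^-1 = a ^- 2 / mu * (a / m%:R).
  by field; rewrite !gt_eqF.
by rewrite ler_wpM2l// !mulr_ge0 ?invr_ge0 ?exprn_ge0 ?ltW.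
Qed.

End IidExpectation.

(** * Multiplicative Chernoff bound *)

Lemma expRN_le_quad {R : realType} (u : R) : 0 <= u -> expR (- u) <= 1 - u + u ^+ 2.
Proof.
move=> u0; rewrite expRN; apply: (@le_trans _ _ (1 + u)^-1).
  by rewrite lef_pV2 ?expR_ge1Dx// ?posrE ?expR_gt0//; lra.
have u1 : 0 < 1 + u by lra.
rewrite -[leLHS]mul1r ler_pdivrMr//.
have -> : (1 - u + u ^+ 2) * (1 + u) = 1 + u ^+ 3 by ring.
by rewrite lerDl exprn_ge0.
Qed.

(** Markov's inequality for the exponential of [- l] times the sum, with [l = a / b]. At this rate
    the quadratic term of the exponential is at most [a] times the linear one, which is the loss
    recorded by the factor [1 - a]. *)
Lemma iidE_chernoff {R : realType} {C : finType} (D z : C -> R) (b a L : R) (n : nat) :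
  (forall c, 0 <= D c) -> \sum_c D c = 1 -> (forall c, 0 <= z c <= b) ->
  0 < b -> 0 < a ->
  iidE D (fun u : {ffun 'I_n -> C} =>
    (\sum_i z (u i) + b * L / a < n%:R * ((1 - a) * \sum_c D c * z c))%R%:R)
  <= expR (- L).
Proof.
move=> D0 D1 zb b0 a0; set v := \sum_c _.
pose l := a / b.
have l0 : 0 < l by rewrite divr_gt0.
have lL : l * (b * L / a) = L by rewrite /l; field; rewrite !gt_eqF.
pose k := expR (- L) * expR (l * (n%:R * ((1 - a) * v))).
apply: (@le_trans _ _ (iidE D (fun u : {ffun 'I_n -> C} =>
    k * \prod_i expR (- (l * z (u i)))))).
  apply: le_iidE => // u; rewrite /k -expR_sum -2!expRD sumrN -mulr_sumr.
  case: ltP => [lt|_]; last exact: expR_ge0.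
  (* On the bad event the exponent is positive, so the exponential dominates the indicator. *)
  apply: (@le_trans _ _ (1 + (- L + l * (n%:R * ((1 - a) * v)) -
    l * \sum_i z (u i)))); last exact: expR_ge1Dx.
  have := ltW lt; rewrite -(ler_pM2l l0) mulrDr lL /=; lra.
rewrite iidEZ (iidE_prod (fun _ c => expR (- (l * z c)))) prodr_const card_ord.
have step : \sum_c D c * expR (- (l * z c)) <= expR (- (l * ((1 - a) * v))).
  apply: (@le_trans _ _ (\sum_c (D c + - (l * (1 - a)) * (D c * z c)))).
    apply: ler_sum => c _; have /andP[z0 zb'] := zb c.
    apply: (@le_trans _ _ (D c * (1 - l * z c + (l * z c) ^+ 2))).
      by rewrite ler_wpM2l// expRN_le_quad// mulr_ge0// ltW.
    (* Since [z c <= b], one factor [l * z c] is at most [l * b = a]. *)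
    have : (l * z c) ^+ 2 <= l * a * z c.
      have -> : (l * z c) ^+ 2 = l * (l * z c) * z c by ring.
      have -> : a = l * b by rewrite /l; field; rewrite gt_eqF.
      by rewrite ler_wpM2r// ler_wpM2l ?ler_wpM2l// ltW.
    by have := D0 c; nra.
  rewrite big_split /= -mulr_sumr D1 -/v.
  have -> : 1 + - (l * (1 - a)) * v = 1 + - (l * ((1 - a) * v)) by ring.
  exact: expR_ge1Dx.
have pos : 0 <= \sum_c D c * expR (- (l * z c)).
  by apply: sumr_ge0 => c _; rewrite mulr_ge0// expR_ge0.
apply: (@le_trans _ _ (k * expR (- (l * ((1 - a) * v))) ^+ n)).
  by rewrite ler_wpM2l ?mulr_ge0 ?expR_ge0// lerXn2r// nnegrE expR_ge0.
rewrite /k -expRM_natl -!expRD ler_expR -lerBrDl.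
rewrite -mulr_natl; lra.
Qed.

(** * Reduction of probabilities and integrals to finite sums *)

Section FiniteValued.
Context {R : realType} {d : measure_display} {X : measurableType d}
  {C : finType} (D : probability X R) (c : X -> C).
Hypothesis mc : forall a, measurable (c @^-1` [set a]).

Definition pmf_of (a : C) : R := fine (D (c @^-1` [set a])).

Lemma pmf_ofE a : (pmf_of a)%:E = D (c @^-1` [set a]).
Proof. by rewrite /pmf_of fineK// fin_num_measure. Qed.

Lemma pmf_of_ge0 a : 0 <= pmf_of a.
Proof. by rewrite /pmf_of fine_ge0. Qed.

Lemma integral_comp_fin (g : C -> R) : (forall a, 0 <= g a) ->
  (\int[D]_x (g (c x))%:E = (\sum_a pmf_of a * g a)%:E)%E.
Proof.
move=> g0.
have gE x : ((g (c x))%:E = \sum_a (g a)%:E * (\1_(c @^-1` [set a]) x)%:E)%E.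
  rewrite (bigD1 (c x))//= big1 => [|a ac]; rewrite indicE.
    by rewrite mem_set// mule1 adde0.
  by rewrite memNset ?mule0//= => cx; rewrite cx eqxx in ac.
under eq_integral do rewrite gE.
rewrite ge0_integral_sum//; last 2 first.
- move=> a; apply/measurable_EFinP/measurable_funM => //.
- by move=> a x _; rewrite lee_fin mulr_ge0.
rewrite -sumEFin; apply: eq_bigr => a _.
rewrite ge0_integralZl//; last 2 first.
- exact/measurable_EFinP.
- by rewrite lee_fin.
by rewrite integral_indic// setIT EFinM muleC pmf_ofE.
Qed.

Lemma sum_pmf_of : \sum_a pmf_of a = 1.
Proof.
have := integral_comp_fin (fun=> 1) (fun=> ler01).
rewrite integral_cst// [X in (_ * X)%E](probability_setT D) mule1 => -[] ->.
by apply: eq_bigr => a _; rewrite mulr1.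
Qed.

Lemma measurable_fin_pred (b : pred C) : measurable [set x | b (c x)].
Proof.
have -> : [set x | b (c x)] = \bigcup_(a in [set a | b a]) (c @^-1` [set a]).
  by apply/seteqP; split=> [x bx|x [a /= ba /= ->]//]; exists (c x).
by apply: fin_bigcup_measurable => //; exact: finite_finset.
Qed.

Lemma probability_fin_pred (b : pred C) :
  (D [set x | b (c x)] = (\sum_a pmf_of a * (b a)%:R)%:E)%E.
Proof.
rewrite -integral_comp_fin => [|a]; last exact: ler0n.
rewrite -[LHS]mul1e -[X in (_ * D X)%E]setIT -integral_indic//.
  rewrite mul1e; apply: eq_integral => x _; rewrite indicE; congr ((nat_of_bool _)%:R%:E).
  by apply/idP/idP => [/set_mem//|bx]; rewrite mem_set.
exact: measurable_fin_pred.
Qed.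

End FiniteValued.

(** * Law of the observed patterns *)

Section IidPatterns.
Context {R : realType} {d d' : measure_display} {Omega : measurableType d}
  {X : measurableType d'} {C : finType} {Pr : probability Omega R}
  {D : probability X R} {x : nat -> Omega -> X} {c : X -> C} (n : nat).
Hypotheses (mc : forall a, measurable (c @^-1` [set a]))
  (iidx : iid_seq Pr D x).

(** Observations are numbered from 1, as in [Vhat]. With [t = n.+2] these are the [t - 1]
    observations before round [t]. *)
Definition pattern (w : Omega) : {ffun 'I_n.+1 -> C} :=
  [ffun i : 'I_n.+1 => c (x i.+1 w)].

(** This is the shape required by [iid_seq]: observation [k] is constrained by coordinate [k.-1] of
    [u], over a duplicate-free list of indices. *)
Lemma preimage_pattern (u : {ffun 'I_n.+1 -> C}) :
  pattern @^-1` [set u] =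
  \bigcap_(k in [set k | k \in [seq i.+1 | i <- map val (enum 'I_n.+1)]])
     (x k @^-1` (c @^-1` [set u (inord k.-1)])).
Proof.
apply/seteqP; split=> [w <- k /= /mapP[_ /mapP[i _ ->] ->]|w H] /=.
  by rewrite /pattern ffunE inord_val.
apply/ffunP => i; rewrite ffunE.
have := H i.+1; rewrite /= inord_val; apply.
by rewrite map_f// map_f// mem_enum.
Qed.

Lemma measurable_pattern u : measurable (pattern @^-1` [set u]).
Proof.
rewrite preimage_pattern; apply: bigcap_measurableType => k _.
by rewrite -[_ @^-1` _]setTI; apply: iidx.1.
Qed.

Lemma pmf_pattern u :
  pmf_of Pr pattern u = \prod_i pmf_of D c (u i).
Proof.
rewrite /pmf_of preimage_pattern iidx.2//.
- rewrite 2!big_map big_enum/=.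
  under eq_bigr do rewrite inord_val -pmf_ofE//.
  by rewrite prodEFin.
- by rewrite (map_inj_uniq succn_inj) (map_inj_uniq val_inj) enum_uniq.
Qed.

Lemma probability_pattern (b : pred {ffun 'I_n.+1 -> C}) :
  (Pr [set w | b (pattern w)] =
   (iidE (pmf_of D c) (fun u => (b u)%:R))%:E)%E.
Proof.
rewrite probability_fin_pred; last exact: measurable_pattern.
by congr EFin; apply: eq_bigr => u _; rewrite pmf_pattern.
Qed.

End IidPatterns.

(** * From empirical distributions to arbitrary ones *)

Lemma iidE_exists_le {R : realType} {C I : finType} (D : C -> R) (n : nat)
    (b : I -> pred {ffun 'I_n -> C}) : (forall c, 0 <= D c) ->
  iidE D (fun u => [exists i, b i u]%:R) <= \sum_i iidE D (fun u => (b i u)%:R).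
Proof.
move=> D0; rewrite -iidE_sum; apply: le_iidE => // u.
case: existsP => [[i biu]|_]; last exact: sumr_ge0.
by rewrite (bigD1 i)//= biu lerDl sumr_ge0.
Qed.

Lemma inv_count_bounds {R : realType} {J : finType} (q mu : R) (S : pred J)
    {m : nat} (f : {ffun 'I_m -> J}) :
  0 <= q -> 0 < mu -> 0 <= inv_count q mu S f <= mu^-1.
Proof.
move=> q0 mu0; rewrite /inv_count.
have c0 : 0 <= q * (m%:R^-1 * \sum_(i < m) (S (f i))%:R).
  by rewrite mulr_ge0// mulr_ge0//; apply: sumr_ge0.
have d0 := ltr_wpDl c0 mu0.
by rewrite invr_ge0 (ltW d0) lef_pV2 ?posrE// lerDr.
Qed.

(** Average the hypothesis over [f] drawn from [P]. The lower half of [sample_inv] serves the left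
    side, where [a <= 1] keeps the factor nonnegative; the upper half serves the right side, with
    bias at most [a]. *)
Lemma empirical_to_dist {R : realType} {J C : finType} (P : J -> R) (D : C -> R)
    (S : C -> pred J) (q mu a B : R) (m n : nat) (u : {ffun 'I_n -> C}) :
  (forall j, 0 <= P j) -> \sum_j P j = 1 -> (forall c, 0 <= D c) ->
  (0 < m)%N -> 0 <= q <= 1 -> 0 < mu -> (m%:R * mu)^-1 <= a <= 1 ->
  (forall f : {ffun 'I_m -> J},
    n%:R * ((1 - a) * \sum_c D c * inv_count q mu (S c) f) <=
    \sum_i inv_count q mu (S (u i)) f + B) ->
  n%:R * ((1 - a) * \sum_c D c * inv_weight q mu (S c) P) <=
  (1 + a) * \sum_i inv_weight q mu (S (u i)) P + B.
Proof.
move=> P0 P1 D0 m0 q01 mu0 /andP[ma a1] dev.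
have samp c := sample_inv P0 P1 (S c) q mu m0 q01 mu0.
apply: (@le_trans _ _ (iidE P (fun f : {ffun 'I_m -> J} =>
    n%:R * ((1 - a) * \sum_c D c * inv_count q mu (S c) f)))).
  rewrite 2!iidEZ iidE_sum ler_wpM2l// ler_wpM2l ?subr_ge0//.
  apply: ler_sum => c _; rewrite iidEZ ler_wpM2l//.
  by have /andP[] := samp c.
apply: (le_trans (le_iidE P0 _ _ dev)).
rewrite iidED iidE_cst// lerD2r iidE_sum mulr_sumr; apply: ler_sum => i _.
have /andP[_ le2] := samp (u i); apply: (le_trans le2).
rewrite ler_wpM2r ?lerD2l// invr_ge0 addr_ge0 ?(ltW mu0)// mulr_ge0//.
  by case/andP: q01.
by apply: sumr_ge0.
Qed.

(** * The exploration rate *)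

Section ExplorationRate.
Context {R : realType} {K N : nat} {delta : R} {t : nat}.
Hypotheses (K0 : (0 < K)%N) (N0 : (0 < N)%N) (delta01 : 0 < delta < 1)
  (t2 : (2 <= t)%N).

Let K1 : 1 <= K%:R :> R. Proof. by rewrite ler1n. Qed.
Let N1 : 1 <= N%:R :> R. Proof. by rewrite ler1n. Qed.
Let tge2 : 2 <= t%:R :> R. Proof. by rewrite ler_nat. Qed.
Let d0 : 0 < delta. Proof. by case/andP: delta01. Qed.
Let d1 : delta < 1. Proof. by case/andP: delta01. Qed.

Lemma C_t_gt0 : 0 < C_t N delta t.
Proof.
rewrite /C_t mulr_gt0// ln_gt0// ltr_pdivlMr// mul1r.
by apply: (lt_trans d1); move: N1 tge2; nra.
Qed.

Lemma mu_t_gt0 : 0 < mu_t K N delta t.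
Proof.
rewrite /mu_t lt_min sqrtr_gt0 divr_gt0 ?C_t_gt0//; last by move: K1 tge2; nra.
by rewrite invr_gt0 andbT; move: K1; lra.
Qed.

Lemma mu_t_le : K%:R * mu_t K N delta t <= 2^-1.
Proof.
have : mu_t K N delta t <= (2 * K%:R)^-1 by rewrite ge_min lexx.
rewrite -(ler_pM2l (_ : 0 < K%:R)); last by move: K1; lra.
by move/le_trans; apply; rewrite invfM mulrCA divff ?mulr1//; move: K1; lra.
Qed.

(** Split [N t / delta] as [8 K N / delta] times [t / (8 K)]. With [p = t / (16 K)], the first
    logarithm is at most [p] by hypothesis and the second at most [2 p] by [ln y < y], giving
    [6 p <= 8 p]. *)
Lemma C_t_le : 16 * K%:R * ln (8 * K%:R * N%:R / delta) <= t%:R ->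
  C_t N delta t <= t%:R / (2 * K%:R).
Proof.
move=> tK; move: (K1) (N1) (tge2) (d0) => K1' N1' t2' d0'.
have K8 : 0 < 8 * K%:R :> R by lra.
have t0 : 0 < t%:R :> R by lra.
have NKd : 0 < 8 * K%:R * N%:R / delta.
  by rewrite divr_gt0// mulr_gt0//; lra.
have -> : C_t N delta t =
    2 * (ln (8 * K%:R * N%:R / delta) + ln (t%:R / (8 * K%:R))).
  rewrite -lnM ?posrE//; last exact: divr_gt0.
  rewrite /C_t; congr (_ * ln _).
  by field; rewrite !gt_eqF//; lra.
have l1 : ln (8 * K%:R * N%:R / delta) <= t%:R / (16 * K%:R).
  by rewrite ler_pdivlMr; lra.
have l2 := ltW (ln_sublinear (divr_gt0 t0 K8)).
have -> : t%:R / (2 * K%:R) = 2 * (4 * (t%:R / (16 * K%:R))) :> R.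
  by field; rewrite gt_eqF//; lra.
have E8 : t%:R / (8 * K%:R) = 2 * (t%:R / (16 * K%:R)) :> R.
  by field; rewrite gt_eqF//; lra.
have p0 : 0 <= t%:R / (16 * K%:R) :> R by rewrite divr_ge0//; lra.
by rewrite E8 in l2 *; lra.
Qed.

(** The bound on [C_t] says exactly that the square root is at most [1 / (2 K)], so it attains the
    minimum. *)
Lemma mu_t_sqr : 16 * K%:R * ln (8 * K%:R * N%:R / delta) <= t%:R ->
  mu_t K N delta t ^+ 2 = C_t N delta t / (2 * K%:R * t%:R).
Proof.
move=> tK; move: (K1) (tge2) => K1' t2'.
have Kt0 : 0 < 2 * K%:R * t%:R :> R by nra.
have C0 := C_t_gt0.
have K20 : 0 < 2 * K%:R :> R by lra.
have le_half : Num.sqrt (C_t N delta t / (2 * K%:R * t%:R)) <= (2 * K%:R)^-1.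
  rewrite -[leRHS]ger0_norm ?invr_ge0 ?(ltW K20)// -sqrtr_sqr ler_wsqrtr//.
  rewrite ler_pdivrMr//; apply: (le_trans (C_t_le tK)).
  rewrite le_eqVlt; apply/orP; left; apply/eqP.
  by field; rewrite gt_eqF//; lra.
by rewrite /mu_t min_r// sqr_sqrtr// divr_ge0// ltW.
Qed.

End ExplorationRate.

(** * Union bound over the rounds *)

Lemma sum_inv_consecutive {R : realType} (n : nat) :
  \sum_(0 <= k < n) (k.+2%:R * k.+1%:R)^-1 = 1 - n.+1%:R^-1 :> R.
Proof.
elim: n => [|n IHn]; first by rewrite big_geq// invr1 subrr.
rewrite big_nat_recr//= IHn.
by field; rewrite !gt_eqF// ltr_wpDr.
Qed.

(** The shares telescope, so every partial sum of the failure probabilities is at most [delta]. *)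
Lemma probability_setC_bigcup_ge {R : realType} {d : measure_display}
    {Omega : measurableType d} (Pr : probability Omega R) (delta : R)
    (A : nat -> set Omega) : 0 <= delta ->
  (forall k, measurable (A k)) ->
  (forall k, (Pr (A k) <= (delta / (k.+2%:R * k.+1%:R))%:E)%E) ->
  (Pr (~` \bigcup_k A k) >= (1 - delta)%:E)%E.
Proof.
move=> delta0 mA PA.
have mU := bigcupT_measurable A mA.
rewrite probability_setC// EFinB leeB//.
apply: (le_trans (generalized_Boole_inequality Pr mA mU)).
apply: lime_le; first by apply: is_cvg_nneseries => k _ _; exact: measure_ge0.
apply: nearW => n.
apply: (@le_trans _ _ (\sum_(0 <= k < n) (delta / (k.+2%:R * k.+1%:R))%:E)%E).
  by apply: lee_sum => k _; exact: PA.
rewrite sumEFin lee_fin -mulr_sumr sum_inv_consecutive.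
by rewrite ler_piMr// gerBl.
Qed.

(** * Failure event of a single round *)

(** The event is a union over the finitely many pairs of a policy and an [m]-tuple of policies, and
    is chosen before [P]; outside it, averaging over tuples covers all [P] at once. The range [b] in
    the Chernoff bound is [mu^-1]. *)
Lemma deviation_event {R : realType} {d d' : measure_display}
    {Omega : measurableType d} {X : measurableType d'} {C J : finType}
    (Pr : probability Omega R) (D : probability X R) (x : nat -> Omega -> X)
    (c : X -> C) (S : J -> C -> pred J) (q mu a L : R) (m n : nat) :
  (forall b, measurable (c @^-1` [set b])) -> iid_seq Pr D x ->
  (0 < m)%N -> 0 <= q <= 1 -> 0 < mu -> 0 < a <= 1 -> (m%:R * mu)^-1 <= a ->
  exists A : set Omega, [/\ measurable A,
    (Pr A <= (#|J|%:R * #|J|%:R ^+ m * expR (- L))%:E)%E &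
    forall w, ~ A w -> forall (P : J -> R) (j : J),
      (forall i, 0 <= P i) -> \sum_i P i = 1 ->
      n.+1%:R * ((1 - a) * \sum_b pmf_of D c b * inv_weight q mu (S j b) P) <=
      (1 + a) * \sum_(i < n.+1) inv_weight q mu (S j (c (x i.+1 w))) P
        + mu^-1 * L / a].
Proof.
move=> mc iidx m0 q01 mu0 /andP[a0 a1] ma.
pose y (jf : J * {ffun 'I_m -> J}) b := inv_count q mu (S jf.1 b) jf.2.
pose bad jf (u : {ffun 'I_n.+1 -> C}) :=
  \sum_i y jf (u i) + mu^-1 * L / a <
  n.+1%:R * ((1 - a) * \sum_b pmf_of D c b * y jf b).
have D0 := @pmf_of_ge0 _ _ _ _ D c.
exists [set w | [exists jf, bad jf (pattern (x := x) (c := c) n w)]]; split.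
- apply: (measurable_fin_pred _ _ (fun u => [exists jf, bad jf u])).
  exact: (measurable_pattern n mc iidx).
- rewrite (probability_pattern _ mc iidx (fun u => [exists jf, bad jf u])).
  rewrite lee_fin; apply: (le_trans (iidE_exists_le _ _ _ D0)).
  apply: (@le_trans _ _ (\sum_(jf : J * {ffun 'I_m -> J}) expR (- L))).
    apply: ler_sum => jf _; apply: iidE_chernoff => //.
    + exact: sum_pmf_of.
    + by move=> b; apply: inv_count_bounds => //; case/andP: q01.
    + by rewrite invr_gt0.
  rewrite sumr_const card_prod card_ffun card_ord -[leLHS]mulr_natl.
  by rewrite natrM natrX.
move=> w /negP; rewrite negb_exists => /forallP good P j P0 P1.
have cE (i : 'I_n.+1) : c (x i.+1 w) = pattern (x := x) (c := c) n w i by rewrite ffunE.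
under [X in _ <= _ * X + _]eq_bigr do rewrite cE.
apply: (empirical_to_dist _ _ _ _ _ _ _ m) => //; first by rewrite ma.
by move=> f; have := good (j, f); rewrite -leNgt.
Qed.

(** * Number of draws and the additive error *)

Section Confidence.
Context {R : realType} (K N : nat) (delta a : R) (k : nat).
Hypotheses (K0 : (0 < K)%N) (N0 : (0 < N)%N) (delta01 : 0 < delta < 1)
  (a01 : 0 < a <= 4^-1).
Let t := k.+2.
Let mu := mu_t K N delta t.

(** An integer just above [1 / (mu a)], which makes the sampling bias [1 / (m mu)] at most [a]. *)
Definition nb_draws : nat := (Num.trunc (mu * a)^-1).+1.
Let m := nb_draws.

(* The union bound runs over N policies and N^m tuples, and round t = k + 2
   receives the share delta / (t (t - 1)) of the failure probability. *)
Definition log_conf : R :=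
  ln (N%:R ^+ m.+1 * (k.+2%:R * k.+1%:R) / delta).

Let mu_gt0 : 0 < mu. Proof. exact: mu_t_gt0. Qed.

Lemma nb_draws_inv_le : (m%:R * mu)^-1 <= a.
Proof.
have /andP[a0 _] := a01; have mu0 := mu_gt0.
have m0 : 0 < m%:R :> R by rewrite ltr0n.
have := truncnS_gt (mu * a)^-1; rewrite -/nb_draws -/m => /ltW.
rewrite -[leLHS]mul1r ler_pdivrMr ?mulr_gt0// => H.
by rewrite -[leLHS]mul1r ler_pdivrMr ?mulr_gt0//; lra.
Qed.

Lemma expRN_log_conf :
  N%:R * N%:R ^+ m * expR (- log_conf) = delta / (k.+2%:R * k.+1%:R).
Proof.
have /andP[d0 _] := delta01.
have N0' : 0 < N%:R :> R by rewrite ltr0n.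
have k1 : 0 < k.+1%:R :> R by [].
have k2 : 0 < k.+2%:R :> R by [].
rewrite expRN lnK ?posrE; last first.
  by rewrite divr_gt0// mulr_gt0 ?exprn_gt0// mulr_gt0.
rewrite -exprS; have : 0 < N%:R ^+ m.+1 :> R by rewrite exprn_gt0.
move: (mulr_gt0 k2 k1) d0; move: (_ ^+ _) (_ * _) => A T T0 d0 A0.
by field; rewrite !gt_eqF.
Qed.

(** [log_conf] is at most [m + 2] copies of [ln (N t / delta) = C_t / 2], and [m + 2 <= 2 / (mu a)].
    The left side is thus at most [C_t / (mu a) ^+ 2], and [mu_t_sqr] turns [C_t / mu ^+ 2] into
    [2 K t]. *)
Lemma log_conf_le : 16 * K%:R * ln (8 * K%:R * N%:R / delta) <= t%:R ->
  mu^-1 * log_conf / a <= 2 * K%:R * t%:R / a ^+ 2.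
Proof.
move=> tK; have /andP[a0 a4] := a01; have mu0 := mu_gt0.
have /andP[d0 d1] := delta01.
have K1 : 1 <= K%:R :> R by rewrite ler1n.
have N1 : 1 <= N%:R :> R by rewrite ler1n.
have k1 : 0 < k.+1%:R :> R by [].
have tk : k.+2%:R = k.+1%:R + 1 :> R by rewrite -natr1.
have C0 : 0 < C_t N delta t by exact: C_t_gt0.
have musqr := mu_t_sqr K0 N0 delta01 (isT : (2 <= t)%N) tK; rewrite -/mu in musqr.
have mua0 : 0 < mu * a by rewrite mulr_gt0.
have B1 : 1 <= N%:R * t%:R / delta.
  by rewrite ler_pdivlMr// mul1r /t tk; nra.
have le1 : log_conf <= m.+2%:R * (C_t N delta t / 2).
  rewrite [C_t N delta t / 2]mulrAC divff// mul1r.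
  rewrite mulr_natl -lnXn; last by apply: lt_le_trans B1.
  rewrite ler_ln ?posrE; last 2 first.
  - by rewrite divr_gt0// mulr_gt0 ?exprn_gt0 ?mulr_gt0//; lra.
  - by rewrite exprn_gt0//; apply: lt_le_trans B1.
  have t1 : 1 <= t%:R :> R by rewrite ler1n.
  have d1' : 1 <= delta^-1 by rewrite invf_ge1// ltW.
  rewrite 2!exprMn; apply: ler_pM.
  - by apply: mulr_ge0; [exact: exprn_ge0|exact: mulr_ge0].
  - by rewrite invr_ge0 ltW.
  - apply: ler_pM; [exact: exprn_ge0|exact: mulr_ge0|exact: ler_weXn2l|].
    apply: (@le_trans _ _ (t%:R ^+ 2)); last exact: ler_weXn2l.
    by rewrite expr2 ler_wpM2l// ler_nat.
  - by rewrite -[leLHS]expr1; apply: ler_weXn2l.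
(* Here [m + 2 <= 1 / (mu a) + 3]; as [mu <= 1/2] and [a <= 1/4], the term [1 / (mu a)] is large
   enough to absorb the 3. *)
have le2 : m.+2%:R <= 2 / (mu * a).
  have : m%:R <= (mu * a)^-1 + 1.
    rewrite /m /nb_draws -natr1 lerD2r.
    have i0 : 0 <= (mu * a)^-1 by rewrite invr_ge0 ltW.
    by case/andP: (truncn_itv i0).
  have mu2 := mu_t_le (N := N) (delta := delta) (t := t) K0; rewrite -/mu in mu2.
  have : 3 <= (mu * a)^-1 - 1.
    rewrite lerBrDr -[leRHS]mul1r ler_pdivlMr//.
    have : mu <= K%:R * mu by rewrite ler_peMl// ltW.
    by nra.
  by rewrite -!natr1; lra.
apply: (@le_trans _ _ (mu^-1 * (2 / (mu * a) * (C_t N delta t / 2)) / a)).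
  rewrite ler_pM2r ?invr_gt0// ler_pM2l ?invr_gt0//.
  by apply: (le_trans le1); rewrite ler_pM2r// divr_gt0.
rewrite le_eqVlt; apply/orP; left; apply/eqP.
have t0 : 0 < t%:R :> R by [].
have Cmu : C_t N delta t = mu ^+ 2 * (2 * K%:R * t%:R).
  by rewrite musqr; field; rewrite !gt_eqF//; lra.
by rewrite Cmu; field; rewrite !gt_eqF.
Qed.

End Confidence.

(** * Final constants and assembly *)

Lemma relative_bound {R : realType} (K eps v h B t n : R) :
  0 < eps < 1 -> 0 <= h -> 1 <= K -> 1 <= n -> t = n + 1 ->
  B <= 2 * K * t / (eps / 4) ^+ 2 ->
  n * ((1 - eps / 4) * v) <= (1 + eps / 4) * (n * h) + B ->
  v <= (1 + eps) * h + 7500 / eps ^+ 3 * K.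
Proof.
move=> /andP[e0 e1] h0 K1 n1 -> leB dev.
(* The argument yields 64, divided by [1 - eps / 4 >= 3/4]; 86 is the next integer above
   [64 * 4/3]. *)
apply: (@le_trans _ _ ((1 + eps) * h + 86 / eps ^+ 3 * K)); last first.
  rewrite lerD2l ler_wpM2r ?ler_wpM2r ?ler_nat ?invr_ge0 ?exprn_ge0 ?(ltW e0)//.
  by lra.
set i := eps^-1; have i0 : 0 < i by rewrite invr_gt0.
have i1 : 1 <= i by rewrite invf_ge1// ltW.
have iE : 2 * K * (n + 1) / (eps / 4) ^+ 2 = 32 * K * (n + 1) * i ^+ 2.
  by rewrite /i; field; rewrite gt_eqF.
have tE : 86 / eps ^+ 3 * K = 86 * K * i ^+ 3.
  by rewrite /i; field; rewrite gt_eqF.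
rewrite tE {tE}; rewrite iE {iE} in leB; clearbody i.
have n0 : 0 < n by lra.
have Ki : 0 < K * i ^+ 2 by rewrite mulr_gt0// ?exprn_gt0//; lra.
(* Uses [n + 1 <= 2 * n]. *)
have leB' : B <= n * (64 * (K * i ^+ 2)) by nra.
have dev' : (1 - eps / 4) * v <= (1 + eps / 4) * h + 64 * (K * i ^+ 2).
  by rewrite -(ler_pM2l n0) mulrDr [n * (_ * h)]mulrCA (le_trans dev)// lerD2l.
have Ki3 : K * i ^+ 2 <= K * i ^+ 3.
  by rewrite ler_wpM2l//; [lra|exact: ler_weXn2l].
have e4 : 0 < 1 - eps / 4 by lra.
rewrite -(ler_pM2l e4); apply: (le_trans dev').
have : (1 + eps / 4) * h <= (1 - eps / 4) * (1 + eps) * h.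
  by rewrite ler_wpM2r//; nra.
have : 64 * (K * i ^+ 2) <= (1 - eps / 4) * (86 * (K * i ^+ 3)) by nra.
lra.
Qed.

Theorem theorem3 (R : realType) (d d' : measure_display)
  (Omega : measurableType d) (X : measurableType d')
  (Pr : probability Omega R) (DX : probability X R)
  (K N : nat) (pol : 'I_N -> X -> 'I_K) (delta : R)
  (x : nat -> Omega -> X) :
  (0 < K)%N -> (0 < N)%N ->
  injective pol ->
  (forall (j : 'I_N) (a : 'I_K), measurable (pol j @^-1` [set a])) ->
  0 < delta < 1 ->
  iid_seq Pr DX x ->
  forall eps : R, 0 < eps < 1 ->
  exists E : set Omega, measurable E /\ (Pr E >= (1 - delta)%:E)%E /\
    forall w, E w ->
    forall (P : 'I_N -> R) (j : 'I_N) (t : nat),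
      is_dist P -> (2 <= t)%N ->
      16 * K%:R * ln (8 * K%:R * N%:R / delta) <= t%:R ->
      (V pol DX delta P j t <=
        ((1 + eps) * Vhat pol delta P j t (fun i => x i w)
          + 7500 / eps ^+ 3 * K%:R)%:E)%E.
Proof.
move=> K0 N0 _ mpol delta01 iidx eps eps01.
(* The vector of all policies' actions determines every [Vterm] and takes finitely many values. *)
pose c (y : X) : {ffun 'I_N -> 'I_K} := [ffun j => pol j y].
have mc b : measurable (c @^-1` [set b]).
  have -> : c @^-1` [set b] = \bigcap_(j in [set: 'I_N]) pol j @^-1` [set b j].
    apply/seteqP; split=> [y <- j _ /=|y H /=]; first by rewrite ffunE.
    by apply/ffunP => j; rewrite ffunE; exact: H.
  by apply: fin_bigcap_measurable => //; exact: finite_finset.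
pose S (j : 'I_N) (b : {ffun 'I_N -> 'I_K}) : pred 'I_N := fun i => b i == b j.
(* One [a] is lost to the Chernoff bound and one to sampling; [(1 + a) / (1 - a) <= 1 + eps] for
   this choice. *)
pose a := eps / 4.
have a01 : 0 < a <= 4^-1 by case/andP: eps01 => ? ?; rewrite /a; lra.
have q01 t : (2 <= t)%N -> 0 <= 1 - K%:R * mu_t K N delta t <= 1.
  move=> t2; have mu2 := mu_t_le (N := N) (delta := delta) (t := t) K0.
  have : 0 <= K%:R * mu_t K N delta t.
    by rewrite mulr_ge0// ltW// mu_t_gt0.
  lra.
have a1 : 0 < a <= 1 by case/andP: a01 => ? ?; lra.
have mu0 k : 0 < mu_t K N delta k.+2 by exact: mu_t_gt0.
(* Index [k] stands for round [t = k + 2], with [k + 1] observations. *)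
have ev k := deviation_event _ _ _ _ S _ _ _ (log_conf K N delta a k)
  (nb_draws K N delta a k) k mc iidx isT (q01 k.+2 isT) (mu0 k) a1
  (nb_draws_inv_le _ _ _ _ k K0 N0 delta01 a01).
have [A /all_and3[mA PA goodA]] := choice ev.
exists (~` \bigcup_k A k); split.
  by apply: measurableC; exact: bigcupT_measurable.
split.
  apply: probability_setC_bigcup_ge => //; first by case/andP: delta01 => /ltW.
  move=> k; apply: (le_trans (PA k)).
  by rewrite card_ord expRN_log_conf.
move=> w goodw P j [|[|k]]// [P0 P1] _ tK.
have {}goodw : ~ A k w by move=> Akw; apply: goodw; exists k.
have VtermE y : Vterm pol delta P j k.+2 y =
    inv_weight (1 - K%:R * mu_t K N delta k.+2) (mu_t K N delta k.+2)
      (S j (c y)) P.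
  rewrite /Vterm /W /inv_weight /S; congr ((_ * _ + _)^-1).
  by apply: eq_bigl => i; rewrite !ffunE.
have /andP[q0 _] := q01 k.+2 isT.
have w0 b : 0 <= inv_weight (1 - K%:R * mu_t K N delta k.+2)
    (mu_t K N delta k.+2) (S j b) P.
  by rewrite invr_ge0 addr_ge0 ?(ltW (mu0 k))// mulr_ge0//; apply: sumr_ge0.
rewrite /V; under eq_integral do rewrite VtermE.
rewrite (integral_comp_fin _ _ mc (fun b => inv_weight _ _ (S j b) P))// lee_fin.
have n0 : 0 < k.+1%:R :> R by [].
apply: (relative_bound _ _ _ _ _ _ k.+1%:R eps01 _ _ _ _
  (log_conf_le _ _ _ _ _ K0 N0 delta01 a01 tK)); rewrite ?ler1n ?natr1//.
  by rewrite /Vhat mulr_ge0//; apply: sumr_ge0 => i _; rewrite VtermE.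
rewrite /Vhat /= mulVKf ?gt_eqF// big_add1 big_mkord.
under [X in _ <= _ * X + _]eq_bigr do rewrite VtermE.
exact: goodA.
Qed.
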